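(* Let $U$ be an infinite subset of $\mathbb Z$. Then the ring $LIP(U)$ contains an infinite strictly increasing chain of principal ideals.
   Context: For an infinite $U\subseteq\mathbb Z$, a function $f\colon U\to\mathbb Z$ is LIP (locally integer polynomial) on $U$ if for every finite $X\subseteq U$ there is $p\in\mathbb Z[x]$ with $p(x)=f(x)$ for all $x\in X$. $LIP(U)$ denotes the ring of all LIP functions on $U$ under pointwise addition and multiplication. *)

(* Defs.v *)
From HB Require Import structures.
From mathcomp Require Import all_boot all_order all_algebra.
From mathcomp Require Import boolp classical_sets functions cardinality.

Set Implicit Arguments.
Unset Strict Implicit.
Unset Printing Implicit Defensive.

Import GRing.Theory.
Local Open Scope classical_set_scope.
Local Open Scope ring_scope.

(* Functions on U are total functions on the subtype of int attached to U, so
   Leibniz equality (with functional extensionality) is equality on U. *)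
Definition locally_int_poly (U : set int) (f : U -> int) : Prop :=
  forall X : set U, finite_set X ->
    exists p : {poly int}, forall x : U, X x -> p.[val x] = f x.

Definition lip_pred (U : set int) : {pred U -> int} :=
  fun f => `[< locally_int_poly f >].
Arguments lip_pred U _ : clear implicits.

Lemma lip_subring_closed (U : set int) : subring_closed (lip_pred U).
Proof.
split=> [|f g /asboolP lf /asboolP lg|f g /asboolP lf /asboolP lg].
- by apply/asboolP => X _; exists 1 => x _; rewrite hornerC.
- apply/asboolP => X finX; have [p pf] := lf X finX; have [q qg] := lg X finX.
  by exists (p - q) => x Xx; rewrite hornerD hornerN pf // qg.
- apply/asboolP => X finX; have [p pf] := lf X finX; have [q qg] := lg X finX.
  by exists (p * q) => x Xx; rewrite hornerM pf // qg.
Qed.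

HB.instance Definition _ (U : set int) :=
  GRing.isSubringClosed.Build (U -> int) (lip_pred U) (@lip_subring_closed U).

(* The ring operations are inherited from the pointwise ones on U -> int.  The
   ring is only declared possibly trivial (pz), since U may be empty here. *)
Record LIP (U : set int) : Type := MkLIP {
  LIP_fun :> U -> int;
  LIP_funP : LIP_fun \in lip_pred U
}.

HB.instance Definition _ (U : set int) := [isSub for @LIP_fun U].
HB.instance Definition _ (U : set int) := [Choice of LIP U by <:].
HB.instance Definition _ (U : set int) :=
  GRing.SubChoice_isSubComPzRing.Build (U -> int) (lip_pred U) (LIP U)
    (@lip_subring_closed U).

Definition principal_ideal (R : comPzRingType) (a : R) : set R :=
  [set a * b | b in [set: R]].

Definition is_principal_ideal (R : comPzRingType) (I : set R) : Prop :=
  exists a : R, I = principal_ideal a.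

(* Main.v *)
(** A product of factors [g n] is locally a polynomial as soon as [g n] is [1]
    on the integers of absolute value less than [n]. With
    [g n = 1 + 3 * \prod_(k < n) (X^2 - k^2)], the tails
    [f m = \prod_(n >= m) g n] are LIP, satisfy [f m = g m * f m.+1], and vanish
    nowhere because [g n] is [1] modulo [3]. If [f m.+1] were a multiple of
    [f m], then [g m] would be invertible, hence [1] or [-1] at every point of
    [U]; but it is not [1] or [-1] at any [u] in [U] with [m <= |u|]. *)
Require Import Defs.
From mathcomp Require Import all_boot all_order all_algebra.
From mathcomp Require Import boolp classical_sets functions cardinality.
From mathcomp Require Import zify.

Set Implicit Arguments.
Unset Strict Implicit.
Unset Printing Implicit Defensive.

Import Order.TTheory GRing.Theory Num.Theory.
Local Open Scope classical_set_scope.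
Local Open Scope ring_scope.

Definition vanishing_poly (n : nat) : {poly int} :=
  \prod_(k < n) ('X ^+ 2 - (k%:Z ^+ 2)%:P).

Definition tail_factor (n : nat) : {poly int} := 1 + 3%:P * vanishing_poly n.

Lemma vanishing_poly_eq0 (n : nat) (x : int) :
  ((vanishing_poly n).[x] == 0) = (`|x| < n)%N.
Proof.
rewrite horner_prod prodf_seq_eq0; apply/hasP/idP => [[k _]|xn].
  rewrite !hornerE subr_eq0 eqf_sqr => /orP xk.
  by have := ltn_ord k; case: xk => /eqP; lia.
exists (Ordinal xn); rewrite ?mem_index_enum// !hornerE /= subr_eq0 eqf_sqr.
by apply/orP; case: (lerP 0 x) => ?; [left|right]; apply/eqP; lia.
Qed.

Lemma tail_factorE (n : nat) (x : int) :
  (tail_factor n).[x] = 1 + 3 * (vanishing_poly n).[x].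
Proof. by rewrite !hornerE. Qed.

Lemma tail_factor_eq1 (n : nat) (x : int) :
  (`|x| < n)%N -> (tail_factor n).[x] = 1.
Proof.
by rewrite -vanishing_poly_eq0 tail_factorE => /eqP ->; rewrite mulr0 addr0.
Qed.

Lemma tail_factor_neq0 (n : nat) (x : int) : (tail_factor n).[x] != 0.
Proof. by rewrite tail_factorE; apply/eqP; lia. Qed.

(** A unit of [int] is [1] or [-1], so [1 + 3 * v] is one only if [3 * v] is [0] or [-2]. The first
    forces [v = 0], excluded by [n <= |x|]; the second fails modulo [3]. *)
Lemma tail_factor_nonunit (n : nat) (x : int) :
  (n <= `|x|)%N -> (tail_factor n).[x] \isn't a GRing.unit.
Proof.
rewrite leqNgt -vanishing_poly_eq0 tail_factorE => /eqP v0.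
by apply/negP => /orP[] /eqP; lia.
Qed.

(** The infinite product over [n >= m], truncated at a bound depending on [x]: the factors with
    [n > |x|] are [1] at [x]. *)
Definition tail_fun (m : nat) (x : int) : int :=
  \prod_(m <= n < maxn m `|x|.+1) (tail_factor n).[x].

(** Enlarging the bound only adds factors equal to [1]. This lets several points, or two consecutive
    tails, share one bound. *)
Lemma tail_funE (m N : nat) (x : int) : (m <= N)%N -> (`|x| < N)%N ->
  tail_fun m x = \prod_(m <= n < N) (tail_factor n).[x].
Proof.
move=> mN xN; have maxN : (maxn m `|x|.+1 <= N)%N by rewrite geq_max mN.
rewrite (big_cat_nat (leq_maxl _ _) maxN) /=.
rewrite [X in _ * X]big_nat_cond [X in _ * X]big1 ?mulr1// => n.
move=> /andP[/andP[+ _] _].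
by rewrite geq_max => /andP[_ /tail_factor_eq1].
Qed.

Lemma tail_fun_recl (m : nat) (x : int) :
  tail_fun m x = (tail_factor m).[x] * tail_fun m.+1 x.
Proof.
rewrite (@tail_funE m (maxn m `|x|).+1) ?(@tail_funE m.+1 (maxn m `|x|).+1);
  try lia.
by rewrite big_ltn// ltnS leq_maxl.
Qed.

Lemma tail_fun_neq0 (m : nat) (x : int) : tail_fun m x != 0.
Proof.
by rewrite prodf_seq_neq0; apply/allP => n _; rewrite tail_factor_neq0.
Qed.

Lemma locally_int_poly_horner (U : set int) (p : {poly int}) :
  locally_int_poly (fun x : U => p.[val x]).
Proof. by move=> X _; exists p. Qed.

Lemma locally_int_poly_tail_fun (U : set int) (m : nat) :
  locally_int_poly (fun x : U => tail_fun m (val x)).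
Proof.
move=> X /finite_seqP[s ->].
(* [N] exceeds the absolute value of every point of [s], so one finite product represents the tail
   on all of [s]. *)
pose N := maxn m (\max_(x <- s) `|val x|%N).+1.
exists (\prod_(m <= n < N) tail_factor n) => x /= xs.
rewrite horner_prod (@tail_funE m N) ?leq_maxl//.
rewrite leq_max ltnS; apply/orP; right.
exact: (leq_bigmax_seq (F := fun y : U => `|val y|%N)).
Qed.

Lemma infinite_set_int_unbounded (U : set int) (n : nat) :
  infinite_set U -> exists x : U, (n <= `|val x|)%N.
Proof.
move=> infU; apply: contrapT => noU; apply: infU.
(* A bounded [U] would lie in the union of the images of [{0, ..., n - 1}] under [k -> k] and
   [k -> -k]. *)
apply: (@sub_finite_set _ _ (Posz @` `I_n `|` (fun k => - Posz k) @` `I_n)).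
  move=> x Ux; have xn : (`|x| < n)%N.
    rewrite ltnNge; apply/negP => nx; apply: noU.
    by exists (SigSub (mem_set Ux)).
  by case: (lerP 0 x) => ?; [left|right]; exists `|x|%N => //; lia.
by rewrite finite_setU; split; apply: finite_image; apply: finite_II.
Qed.

Definition LIP_of (U : set int) (f : U -> int) (lf : locally_int_poly f) :
  LIP U := MkLIP (introT (asboolP (locally_int_poly f)) lf).

Lemma LIP_funM (U : set int) (f g : LIP U) (x : U) : (f * g) x = f x * g x.
Proof. by []. Qed.

Lemma LIP_ext (U : set int) (f g : LIP U) : (forall x : U, f x = g x) -> f = g.
Proof. by move=> fg; apply: val_inj; apply/funext. Qed.

Lemma principal_ideal_proper (R : comPzRingType) (a b c : R) :
  a = b * c -> ~ (exists d, a * d = b) ->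
  principal_ideal a `<` principal_ideal b.
Proof.
move=> abc ndvd; split=> [_ [d _ <-]|sub].
  by exists (c * d); rewrite // abc mulrA.
(* The generator [b = b * 1] would lie in the ideal of [a]. *)
have [|d _ ad] := sub b; first by exists 1; rewrite ?mulr1.
by apply: ndvd; exists d.
Qed.

Theorem theorem4 (U : set int) (infU : infinite_set U) :
  exists I : nat -> set (LIP U),
    (forall n : nat, is_principal_ideal (I n)) /\
    (forall n : nat, I n `<` I n.+1).
Proof.
pose f m := LIP_of (@locally_int_poly_tail_fun U m).
pose g m := LIP_of (locally_int_poly_horner (U := U) (tail_factor m)).
exists (fun m => principal_ideal (f m)); split=> m; first by exists (f m).
apply: (@principal_ideal_proper _ _ _ (g m)).
  by apply: LIP_ext => x; rewrite LIP_funM mulrC; apply: tail_fun_recl.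
case=> h fh; have [x mx] := infinite_set_int_unbounded m infU.
(* At [x], [fh] becomes [g m * f m.+1 * h = f m.+1]; cancelling the nonzero value of [f m.+1] makes
   [h x] an inverse of the value of [g m]. *)
apply/negP: (tail_factor_nonunit mx); apply/negPn/unitrPr; exists (h x).
apply: (mulIf (tail_fun_neq0 m.+1 (val x))).
by rewrite mulrAC -tail_fun_recl mul1r -[RHS](congr1 (fun u : LIP U => u x) fh).
Qed.
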